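(* Let $m=2$. Suppose that a simplex $s\in\mathcal{S}(x)$ formed by vertices $x=0$, $z_1$, and $z_2$ is monotone causal for a specific $\mathcal{V}(x)$ and that $0<\delta\le\min\bigl(C_1=\frac{|z_1|}{f_1},\ C_2=\frac{|z_2|}{f_2}\bigr)$. This simplex is monotone $\delta$-causal if $\mathcal{V}_s$ is contained in the quadrilateral with vertices $x=0$, $v_1$, $v_2$, and $w(\delta)=\theta_1^{\#}(\delta)v_1+\theta_2^{\#}(\delta)v_2$, where $$\theta_1^{\#}(\delta)=\frac{C_1(C_2-\delta)}{C_1C_2-\delta^2}\quad\text{and}\quad\theta_2^{\#}(\delta)=\frac{C_2(C_1-\delta)}{C_1C_2-\delta^2}.$$
   Context: Fix a point $x=0$ (coordinates centered at $x$) of an open $\Omega\subset\mathbb{R}^2$ and a Lipschitz continuous speed function with values $f(x,a)\in[F_1,F_2]$, $0<F_1\leq F_2<\infty$, for unit vectors $a\in S_1\subset\mathbb{R}^2$. The speed profile is $\mathcal{V}=\mathcal{V}(x)=\{f(x,a)a:a\in S_1\}$. $\mathcal{S}(x)$ is the set of simplexes forming the stencil at $x$; the simplex $s$ has vertices $0,z_1,z_2$ with $z_1,z_2$ linearly independent. $\Xi_2=\{\xi\in\mathbb{R}^2:\xi_j\ge0,\ \xi_1+\xi_2=1\}$. For $\xi\in\Xi_2$: $\tilde x_\xi=\xi_1z_1+\xi_2z_2$, $a_\xi=\tilde x_\xi/|\tilde x_\xi|$, and the cost is $C(\xi)=|\tilde x_\xi|/f(x,a_\xi)$. $f_j=f(x,z_j/|z_j|)$,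 $v_j=f_jz_j/|z_j|$, $C_j=|z_j|/f_j$. $\mathcal{V}_s=\{v\in\mathcal{V}:v=\theta_1v_1+\theta_2v_2,\ \theta_1,\theta_2\ge0\}$. The boundary of the quadrilateral visits the vertices in the order $0,v_1,w(\delta),v_2$. In the degenerate case $\delta=C_1=C_2$ (where the formulas read $0/0$) it is understood as the triangle with vertices $0,v_1,v_2$. The simplex $s$ is monotone causal if for arbitrary vertex values $W_1,W_2\in\mathbb{R}$ there is a minimizer $\xi^*\in\Xi_2$ of $C(\xi)+\xi_1W_1+\xi_2W_2$ such that the minimum value is strictly greater than $W_j$ for every $j$ with $\xi^*_j>0$. For $\delta>0$ it is monotone $\delta$-causal if for arbitrary $W_1,W_2\in\mathbb{R}$ there is a minimizer $\xi^*$ such that the minimum value is $\ge W_j+\delta$ for every $j$ with $\xi_j^*>0$. (This is monotone ($\delta$-)causality of the corresponding mode of the stochastic shortest path problem obtained by semi-Lagrangian discretization, in which choosing $\xi$ costs $C(\xi)$ and leads to $z_j$ with probability $\xi_j$.) *)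

(* Defs.v *)
From HB Require Import structures.
From mathcomp Require Import all_boot all_order all_algebra.
From mathcomp Require Import all_classical all_reals all_analysis.

Set Implicit Arguments.
Unset Strict Implicit.
Unset Printing Implicit Defensive.

Import Order.TTheory GRing.Theory Num.Theory.
Import numFieldNormedType.Exports.

Local Open Scope classical_set_scope.
Local Open Scope ring_scope.

Section Defs.
Variable R : realType.

Local Notation plane := 'rV[R]_2.

(** The library norm on ['rV_2] is the sup norm, hence a separate Euclidean
    norm. *)
Definition enorm (x : plane) : R := Num.sqrt (\sum_i x 0 i ^+ 2).

Definition unit_circle : set plane := [set a | enorm a = 1].

Definition direction (x : plane) : plane := (enorm x)^-1 *: x.

(** A simplex with one vertex at the origin. The indices [0] and [1] of ['I_2]
    stand for the mathematical indices 1 and 2, here and everywhere below. *)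
Record simplex := Simplex {
  vertex :> 'I_2 -> plane;
  vertex_free : free [:: vertex 0; vertex 1]
}.

Section AtOrigin.
(** [phi a] is the speed f(0, a) at the origin in the direction [a]; only its
    values on the unit circle matter. *)
Variable phi : plane -> R.

Definition speed_profile : set plane :=
  [set v | exists2 a, unit_circle a & v = phi a *: a].

Variable s : simplex.

Definition vertex_speed (j : 'I_2) : R := phi (direction (s j)).

Definition vertex_velocity (j : 'I_2) : plane :=
  vertex_speed j *: direction (s j).

Definition vertex_cost (j : 'I_2) : R := enorm (s j) / vertex_speed j.

(** The part of the speed profile in the cone spanned by the simplex. *)
Definition simplex_profile : set plane :=
  [set v | speed_profile v /\ exists t : 'I_2 -> R,
     (forall j, 0 <= t j) /\ v = \sum_j t j *: vertex_velocity j].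

Definition prob_simplex : set 'rV[R]_2 :=
  [set xi | (forall j, 0 <= xi 0 j) /\ \sum_j xi 0 j = 1].

Definition waypoint (xi : 'rV[R]_2) : plane := \sum_j xi 0 j *: s j.

Definition cost (xi : 'rV[R]_2) : R :=
  enorm (waypoint xi) / phi (direction (waypoint xi)).

Definition objective (W : 'I_2 -> R) (xi : 'rV[R]_2) : R :=
  cost xi + \sum_j xi 0 j * W j.

Definition is_minimizer (W : 'I_2 -> R) (xi : 'rV[R]_2) : Prop :=
  prob_simplex xi /\
  forall eta, prob_simplex eta -> objective W xi <= objective W eta.

Definition monotone_causal : Prop :=
  forall W : 'I_2 -> R, exists2 xi, is_minimizer W xi &
    forall j, 0 < xi 0 j -> W j < objective W xi.

Definition monotone_delta_causal (delta : R) : Prop :=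
  forall W : 'I_2 -> R, exists2 xi, is_minimizer W xi &
    forall j, 0 < xi 0 j -> W j + delta <= objective W xi.

End AtOrigin.

Definition segment (p q : plane) : set plane :=
  [set x | exists2 t : R, 0 <= t <= 1 & x = (1 - t) *: p + t *: q].

(** The closed polygonal line visiting the points of [ps] in this order and
    then returning to the first one. *)
Definition closed_polyline (ps : seq plane) : set plane :=
  [set x | exists2 e, e \in zip ps (rot 1 ps) & segment e.1 e.2 x].

(** The closed region enclosed by that line: the line together with the
    bounded connected components of its complement. *)
Definition polygon (ps : seq plane) : set plane :=
  [set x | closed_polyline ps x \/
           bounded_set (connected_component (~` closed_polyline ps) x)].

Section Quadrilateral.
Variables (phi : plane -> R) (s : simplex) (delta : R).

Let C := vertex_cost phi s.
Let v := vertex_velocity phi s.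

(** [1 - j], computed modulo 2, is the index other than [j]. *)
Definition theta_sharp (j : 'I_2) : R :=
  C j * (C (1 - j) - delta) / (C 0 * C 1 - delta ^+ 2).

Definition w_point : plane := \sum_j theta_sharp j *: v j.

(** When [delta = C 0 = C 1] both coefficients [theta_sharp j] read 0/0 and
    the quadrilateral degenerates to a triangle. *)
Definition causal_quadrilateral : set plane :=
  if (delta == C 0) && (delta == C 1) then polygon [:: 0; v 0; v 1]
  else polygon [:: 0; v 0; w_point; v 1].

End Quadrilateral.
End Defs.

(* Main.v *)
Require Import Defs.
From HB Require Import structures.
From mathcomp Require Import all_boot all_order all_algebra.
From mathcomp Require Import all_classical all_reals all_analysis.
From mathcomp Require Import ring lra.

Set Implicit Arguments.
Unset Strict Implicit.
Unset Printing Implicit Defensive.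

Import Order.TTheory GRing.Theory Num.Theory.
Import numFieldNormedType.Exports.

Local Open Scope classical_set_scope.
Local Open Scope ring_scope.

(** Write [j'] for the index other than [j]. The proof has two halves.

    Geometry. In the coordinates [(theta_1, theta_2)] with respect to [v_1],
    [v_2], the quadrilateral lies on or below the two lines
    [theta_j + (delta / C_j') theta_j' = 1]: the line for [j] passes through
    [v_j] and [w], and [v_j'] is on or below it because [delta <= C_j']. (When
    [delta = C_1 = C_2] both are the line through [v_1] and [v_2].) The point
    of the speed profile in the direction of the waypoint of [xi] has
    coordinates [theta_i = xi_i C_i / C(xi)], so that the inclusion of the
    profile in the quadrilateral yields, for both [j],
      [xi_j C_j + xi_j' delta <= C(xi)]        ([cost_ge_affine]).
    Since the region enclosed by a polygonal line is defined through bounded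
    components of a complement, its inclusion in a half-plane has to be shown
    topologically: a point beyond the line escapes to infinity along a ray
    that never meets the polygonal line ([polygon_le]).

    Optimization. Let [V] be the minimum value, attained at [xi] with
    [xi_j > 0]. Comparing [xi] with the vertex [j'] gives [V <= C_j' + W_j'].
    Substituting this in the bound above, taken for [j'],
      [V = C(xi) + xi_j W_j + xi_j' W_j'
         >= xi_j (W_j + delta) + xi_j' (C_j' + W_j')
         >= xi_j (W_j + delta) + xi_j' V],
    and since [xi_j + xi_j' = 1] this says [V >= W_j + delta]
    ([minimizer_delta_causal]). Monotone causality provides the minimizer. *)

(** * Indices in ['I_2] *)

Lemma neq_ord2 (i j : 'I_2) : (i != j) = (i == 1 - j).
Proof. by move: i j; do 2![case=> [[|[|//]] ?]]. Qed.

Lemma sum_ord2 (V : nmodType) (F : 'I_2 -> V) (j : 'I_2) :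
  \sum_i F i = F j + F (1 - j).
Proof.
rewrite (bigD1 j) //= (big_pred1 (1 - j)) // => i; exact: neq_ord2.
Qed.

Lemma subKord2 (j : 'I_2) : 1 - (1 - j) = j.
Proof. by rewrite opprB addrC subrK. Qed.

(** * Polygons and half-planes *)

Section HalfPlane.
Variable R : realType.
Local Notation plane := 'rV[R]_2.

Lemma mem_zip_rot1 (T : eqType) (ps : seq T) (e : T * T) :
  e \in zip ps (rot 1 ps) -> (e.1 \in ps) /\ (e.2 \in ps).
Proof.
case: e => p q /= pq.
have sz : size ps = size (rot 1 ps) by rewrite size_rot.
split.
  by rewrite -[ps](@unzip1_zip _ _ ps (rot 1 ps)) ?sz //; apply/mapP; exists (p, q).
rewrite -(mem_rot 1) -[rot 1 ps](@unzip2_zip _ _ ps (rot 1 ps)) ?sz //.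
by apply/mapP; exists (p, q).
Qed.

(** Both ends of every edge are among the listed points, and a half-plane is
    convex. *)
Lemma closed_polyline_le (l : {scalar plane}) (c : R) (ps : seq plane) :
  (forall p, p \in ps -> l p <= c) ->
  forall x, closed_polyline ps x -> l x <= c.
Proof.
move=> lps x [e /mem_zip_rot1[/lps l1 /lps l2] [t /andP[t0 t1] ->]].
rewrite linearD !linearZ /=; nra.
Qed.

Lemma ray_unbounded (V : normedModType R) (A : set V) (x u : V) : u != 0 ->
  (forall t : R, 0 <= t -> A (x + t *: u)) -> ~ bounded_set A.
Proof.
move=> u0 rayA /pinfty_ex_gt0[M M0 boundA].
have nu : 0 < `|u| by rewrite normr_gt0.
pose t := (M + `|x| + 1) / `|u|.
have t0 : 0 <= t by rewrite divr_ge0 ?addr_ge0 // ltW.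
have := boundA _ (rayA t t0).
rewrite /= leNgt => /negP; apply.
have tu : `|t *: u| = M + `|x| + 1.
  by rewrite normrZ ger0_norm // divfK // gt_eqF.
have := ler_normB (x + t *: u) x.
rewrite addrAC subrr add0r tu; lra.
Qed.

(** A half-plane containing the vertices contains the boundary line. From a
    point [x] outside the half-plane, a ray along which [l] does not decrease
    stays outside it, hence avoids the boundary; it is connected and unbounded,
    and so is not contained in a bounded component of the complement. *)
Lemma polygon_le (l : {scalar plane}) (c : R) (ps : seq plane) :
  (forall p, p \in ps -> l p <= c) -> forall x, polygon ps x -> l x <= c.
Proof.
move=> lps x; case=> [|bx]; first exact: closed_polyline_le.
rewrite leNgt; apply/negP => cx.
(* A nonzero direction with the right sign exists even if [l = 0]. *)
have [u u0 lu] : exists2 u : plane, u != 0 & 0 <= l u.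
  have n0 : const_mx 1 != 0 :> plane.
    by apply/eqP => /rowP/(_ 0)/eqP; rewrite !mxE oner_eq0.
  have [l0|/ltW l0] := leP 0 (l (const_mx 1)); first by exists (const_mx 1).
  by exists (- const_mx 1); rewrite ?oppr_eq0 // linearN oppr_ge0.
apply: (ray_unbounded (x := x) u0 _ bx) => t t0.
pose ray := (fun r : R => x + r *: u) @` `[0, +oo[.
have rayP r : 0 <= r -> ray (x + r *: u).
  by move=> r0; exists r => //=; rewrite in_itv /= r0.
exists ray; last exact: rayP.
split.
- by have := rayP 0 (lexx _); rewrite scale0r addr0.
- move=> y [r]; rewrite /= in_itv /= andbT => r0 <- /(closed_polyline_le lps).
  by rewrite linearD linearZ /=; apply/negP; rewrite -ltNge; nra.
- apply: connected_continuous_connected.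
    exact/connected_intervalP/interval_is_interval.
  apply: continuous_subspaceT => r.
  by apply: cvgD; [exact: cvg_cst|apply: cvgZr_tmp; exact: cvg_id].
Qed.

End HalfPlane.

(** * Costs and speed profile of a simplex *)

Section Simplex.
Variables (R : realType) (phi : 'rV[R]_2 -> R) (s : simplex R).
Local Notation plane := 'rV[R]_2.
Local Notation C := (vertex_cost phi s).
Local Notation v := (vertex_velocity phi s).

Lemma enorm_gt0 (x : plane) : x != 0 -> 0 < enorm x.
Proof.
move=> x0; rewrite sqrtr_gt0 lt_neqAle sumr_ge0 ?andbT; last first.
  by move=> i _; exact: sqr_ge0.
apply: contra x0 => /eqP/esym/eqP; rewrite psumr_eq0; last first.
  by move=> i _; exact: sqr_ge0.
move=> /allP x0; apply/eqP/rowP => i; rewrite mxE.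
by apply/eqP; have := x0 i (mem_index_enum _); rewrite sqrf_eq0.
Qed.

Lemma unit_direction (x : plane) : x != 0 -> unit_circle (direction x).
Proof.
move=> /enorm_gt0 x0; rewrite /unit_circle /= /direction {1}/enorm.
under eq_bigr do rewrite mxE exprMn.
rewrite -mulr_sumr sqrtrM ?sqr_ge0 // sqrtr_sqr ger0_norm ?invr_ge0 ?ltW //.
by rewrite -/(enorm x) mulVf // gt_eqF.
Qed.

Lemma vertex_velocityE j : v j = (C j)^-1 *: s j.
Proof. by rewrite /vertex_velocity scalerA invf_div. Qed.

(** The vertices other than the origin are a free family, so that the
    coordinates with respect to them are linear forms. *)
Lemma simplex_functional (a : 'I_2 -> R) :
  exists l : {scalar plane}, forall j, l (s j) = a j.
Proof.
pose X := [tuple s 0; s 1].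
have Xi (i : 'I_2) : X`_i = s i.
  by case: i => [[|[|//]] ?] /=; congr (s _); apply/val_inj.
have lin : scalar (fun x => \sum_j a j * coord X j x).
  move=> k x y /=; rewrite mulr_sumr -big_split; apply: eq_bigr => j _ /=.
  by rewrite linearP /= mulrDr mulrCA.
pose L := GRing.isLinear.Build _ _ _ _ _ lin.
pose l : {scalar plane} := HB.pack (fun x => \sum_j a j * coord X j x) L.
exists l => j /=.
rewrite (bigD1 j) //= big1 => [|i ij].
  by rewrite -Xi coord_free ?eqxx ?mulr1 ?addr0 //; exact: vertex_free.
rewrite -Xi coord_free; last exact: vertex_free.
by rewrite eq_sym (negPf ij) mulr0.
Qed.

(** The linear form equal to 1 at both vertices takes the value 1 at every
    waypoint. *)
Lemma waypoint_neq0 xi : prob_simplex xi -> waypoint s xi != 0.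
Proof.
move=> [_ xi1]; apply: contra_eq_neq xi1 => wp0.
have [l ls] := simplex_functional (fun=> 1).
suff -> : \sum_j xi 0 j = l (waypoint s xi).
  by rewrite wp0 linear0 eq_sym oner_eq0.
by rewrite linear_sum; apply: eq_bigr => j _; rewrite linearZ /= ls mulr1.
Qed.

Lemma cost_gt0 xi : (forall a, unit_circle a -> 0 < phi a) ->
  prob_simplex xi -> 0 < cost phi s xi.
Proof.
move=> phi0 /waypoint_neq0 wp0.
by rewrite divr_gt0 ?enorm_gt0 // phi0 //; exact: unit_direction.
Qed.

(** Traveling for the time [cost phi s xi] at the velocity of the profile leads
    from the origin to the waypoint; as [s j = C j *: v j], the coordinates of
    that velocity with respect to the [v j] are
    [xi 0 j * C j / cost phi s xi]. *)
Lemma mem_simplex_profile xi : (forall j, 0 < C j) ->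
  (forall a, unit_circle a -> 0 < phi a) -> prob_simplex xi ->
  simplex_profile phi s ((cost phi s xi)^-1 *: waypoint s xi).
Proof.
move=> C0 phi0 xiP; have c0 := cost_gt0 phi0 xiP; split.
  exists (direction (waypoint s xi)); first exact/unit_direction/waypoint_neq0.
  by rewrite scalerA invf_div.
exists (fun j => (cost phi s xi)^-1 * xi 0 j * C j); split.
  move=> j; apply/mulr_ge0/ltW/C0; apply: mulr_ge0; last exact: xiP.1.
  by rewrite invr_ge0 ltW.
rewrite scaler_sumr; apply: eq_bigr => j _.
by rewrite vertex_velocityE !scalerA mulfK // gt_eqF.
Qed.

(** The form [l] is 1 at [v j], at most 1 at [v (1 - j)], and, unless
    [delta = C 0 = C 1], the coefficients [theta_sharp] are those of the common
    point of the lines [l = 1] for the two values of [j]. *)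
Lemma causal_quadrilateral_le (delta : R) (j : 'I_2) (l : {scalar plane}) :
  0 < delta -> (forall i, delta <= C i) ->
  l (s j) = C j -> l (s (1 - j)) = delta ->
  forall x, causal_quadrilateral phi s delta x -> l x <= 1.
Proof.
move=> d0 dC lj lj' x.
have C0 i : 0 < C i by exact: lt_le_trans (dC i).
have lvj : l (v j) = 1.
  by rewrite vertex_velocityE linearZ /= lj mulVf // gt_eqF.
have lvj' : l (v (1 - j)) = delta / C (1 - j).
  by rewrite vertex_velocityE linearZ /= lj' mulrC.
have lv i : l (v i) <= 1.
  have [->|] := eqVneq i j; first by rewrite lvj.
  by rewrite neq_ord2 => /eqP ->; rewrite lvj' ler_pdivrMr ?mul1r.
have prodC : C 0 * C 1 = C j * C (1 - j).
  have [<-|] := eqVneq 0 j; first by rewrite subr0.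
  by rewrite neq_ord2 => /eqP e; rewrite -e -{1}[j]subKord2 -e subr0 mulrC.
rewrite /causal_quadrilateral; case: ifPn => [_|degen].
  apply: polygon_le => p; rewrite !inE.
  by case/or3P => /eqP ->; rewrite ?linear0.
(* Off the degenerate case one of the inequalities [delta <= C i] is strict,
   and the common denominator of [theta_sharp] is positive. *)
have dd : delta ^+ 2 < C j * C (1 - j).
  rewrite -prodC; move: degen; rewrite negb_and expr2 => /orP[] /negP ne.
    have : delta < C 0 by rewrite lt_neqAle dC andbT; apply/negP.
    have := dC 1; nra.
  have : delta < C 1 by rewrite lt_neqAle dC andbT; apply/negP.
  have := dC 0; nra.
have lZ a i : l (a *: v i) = a * l (v i) by rewrite linearZ.
have lw : l (w_point phi s delta) = 1.
  rewrite /w_point (sum_ord2 _ j) linearD !lZ lvj lvj' /theta_sharp.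
  rewrite subKord2 prodC; have := C0 (1 - j).
  move: dd; move: (C j) (C (1 - j)) => a b dd b0.
  field.
  by rewrite subr_eq0 !gt_eqF //.
apply: polygon_le => p; rewrite !inE.
by case/or4P => /eqP ->; rewrite ?linear0 ?lw.
Qed.

(** The left-hand side is the value at the waypoint of the linear form of
    [causal_quadrilateral_le], and dividing the waypoint by its cost gives a
    point of the profile. *)
Lemma cost_ge_affine (delta : R) (j : 'I_2) xi :
  0 < delta -> (forall i, delta <= C i) ->
  (forall a, unit_circle a -> 0 < phi a) ->
  simplex_profile phi s `<=` causal_quadrilateral phi s delta ->
  prob_simplex xi ->
  xi 0 j * C j + xi 0 (1 - j) * delta <= cost phi s xi.
Proof.
move=> d0 dC phi0 sub xiP.
have C0 i : 0 < C i by exact: lt_le_trans (dC i).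
have [l ls] := simplex_functional (fun i => if i == j then C j else delta).
have lj : l (s j) = C j by rewrite ls eqxx.
have lj' : l (s (1 - j)) = delta.
  by rewrite ls ifN // eq_sym neq_ord2 subKord2.
have := causal_quadrilateral_le d0 dC lj lj' (sub _ (mem_simplex_profile C0 phi0 xiP)).
rewrite linearZ /= mulrC ler_pdivrMr ?cost_gt0 // mul1r.
by rewrite /waypoint (sum_ord2 _ j) linearD !linearZ /= lj lj'.
Qed.

Lemma objective_vertex (W : 'I_2 -> R) j :
  objective phi s W (delta_mx 0 j) = C j + W j.
Proof.
have sumE (V : lmodType R) (F : 'I_2 -> V) :
    \sum_i (delta_mx 0 j : plane) 0 i *: F i = F j.
  rewrite (bigD1 j) //= big1 => [|i ij].
    by rewrite mxE !eqxx scale1r addr0.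
  by rewrite mxE (negPf ij) scale0r.
by rewrite /objective /cost /waypoint sumE (sumE R^o).
Qed.

Lemma prob_simplex_vertex j : prob_simplex (delta_mx 0 j : plane).
Proof.
split=> [i|]; first by rewrite mxE; case: (_ && _).
rewrite (bigD1 j) //= big1 => [|i ij]; first by rewrite mxE !eqxx addr0.
by rewrite mxE (negPf ij).
Qed.

(** Minimality bounds [C (1 - j) + W (1 - j)] below by the optimal value [V];
    the assumed bound of [cost phi s xi] then bounds [V] below by a convex
    combination of [W j + delta] and [V] itself. *)
Lemma minimizer_delta_causal (W : 'I_2 -> R) (delta : R) (j : 'I_2) xi :
  is_minimizer phi s W xi -> 0 < xi 0 j ->
  xi 0 j * delta + xi 0 (1 - j) * C (1 - j) <= cost phi s xi ->
  W j + delta <= objective phi s W xi.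
Proof.
move=> [[xi0 xi1] ximin] xij bound.
have := ximin _ (prob_simplex_vertex (1 - j)); rewrite objective_vertex.
have := xi0 (1 - j); move: xi1; rewrite (sum_ord2 _ j).
set V := objective phi s W xi => xi1 xij' Vmin.
have VE : V = cost phi s xi + (xi 0 j * W j + xi 0 (1 - j) * W (1 - j)).
  by rewrite /V /objective (sum_ord2 _ j).
rewrite -(ler_pM2l xij).
have := ler_wpM2l xij' Vmin.
have : V = xi 0 j * V + xi 0 (1 - j) * V by rewrite -mulrDl xi1 mul1r.
lra.
Qed.

End Simplex.

Theorem theorem18 (R : realType) (Omega : set 'rV[R]_2)
  (Omega_open : open Omega) (Omega0 : Omega 0)
  (F1 F2 : R) (F1_gt0 : 0 < F1) (F12 : F1 <= F2)
  (f : 'rV[R]_2 -> 'rV[R]_2 -> R)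
  (f_lipschitz :
     [lipschitz f p.1 p.2 | p in Omega `*` @unit_circle R])
  (f_bounds : forall x a, Omega x -> unit_circle a -> F1 <= f x a <= F2)
  (S : set (simplex R)) (s : simplex R) (sS : S s)
  (s_causal : monotone_causal (f 0) s)
  (delta : R) (delta_gt0 : 0 < delta)
  (delta_le : delta <= Num.min (vertex_cost (f 0) s 0) (vertex_cost (f 0) s 1))
  (profile_sub : simplex_profile (f 0) s `<=`
                 causal_quadrilateral (f 0) s delta) :
  monotone_delta_causal (f 0) s delta.
Proof.
move=> W; have [xi ximin _] := s_causal W; exists xi => // j xij.
apply: minimizer_delta_causal => //.
have dC i : delta <= vertex_cost (f 0) s i.
  move: delta_le; rewrite le_min => /andP[d0 d1].
  have [->//|] := eqVneq i 0.
  by rewrite neq_ord2 subr0 => /eqP ->.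
have phi0 a : unit_circle a -> 0 < f 0 a.
  by move=> /(f_bounds 0 a Omega0)/andP[+ _]; exact: lt_le_trans.
have := cost_ge_affine (1 - j) delta_gt0 dC phi0 profile_sub ximin.1.
by rewrite subKord2 addrC.
Qed.
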